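(* For every finite word $w$ in $\{0,1,2\}$ and every $j\in\{0,1,2\}$, $$\frac15\left(b_j^{(w)}-\frac13\right)=\frac14\left(\frac{\nu(F_wF_jSG)}{\nu(F_wSG)}-\frac13\right).$$
   Context: Let $q_0,q_1,q_2$ be the vertices of an equilateral triangle in $\mathbb{R}^2$, $F_i(x)=\frac12(x+q_i)$, and let $SG$ be the unique nonempty compact set with $SG=\bigcup_{i=0}^2F_i(SG)$. For a finite (possibly empty) word $w=(w_1,\dots,w_m)$ in $\{0,1,2\}$ put $|w|=m$, $F_w=F_{w_1}\circ\cdots\circ F_{w_m}$. For continuous $u,v$ on $SG$ put $\mathcal{E}_m(u,v)=\left(\frac53\right)^m\sum_{|w|=m}\sum_{i<j}(u(F_wq_i)-u(F_wq_j))(v(F_wq_i)-v(F_wq_j))$, $\mathcal{E}(u,v)=\lim_m\mathcal{E}_m(u,v)$ (finite energy), $\mathcal{E}(u)=\mathcal{E}(u,u)$. A function $h$ is harmonic if $\mathcal{E}_m(h,h)$ is independent of $m$; harmonic functions are uniquely determined by arbitrary values at $q_0,q_1,q_2$, and $h_i$ is the harmonic function with $h_i(q_j)=\delta_{ij}$. $\nu_i$ is the finite Borel measure on $SG$ with $\nu_i(F_wSG)=\left(\frac53\right)^{|w|}\mathcal{E}(h_i\circ F_w)$ for all $w$; $\nu=\nu_0+\nu_1+\nu_2$ is the Kusuoka measure. Let $$M_0=\tfrac1{15}\begin{pmatrix}9&0&0\\2&2&-1\\2&-1&2\end{pmatrix},\quad M_1=\tfrac1{15}\begin{pmatrix}2&2&-1\\0&9&0\\-1&2&2\end{pmatrix},\quad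 M_2=\tfrac1{15}\begin{pmatrix}2&-1&2\\-1&2&2\\0&0&9\end{pmatrix},$$ $M_w=M_{w_1}\cdots M_{w_m}$ (identity for the empty word), and, with columns indexed by $0,1,2$, $$b_j^{(w)}=\frac16+\frac12\cdot\frac{\text{sum of the entries of column } j\text{ of }M_w}{\text{sum of all entries of }M_w}.$$ *)

(* Defs.v *)
From HB Require Import structures.
From mathcomp Require Import all_boot all_order all_algebra.
From mathcomp Require Import all_classical all_reals all_analysis.
Import Order.TTheory GRing.Theory Num.Theory.
Import numFieldNormedType.Exports.

Set Implicit Arguments.
Unset Strict Implicit.
Unset Printing Implicit Defensive.

Local Open Scope classical_set_scope.
Local Open Scope ring_scope.

Notation word := (seq 'I_3).

Section Gasket.
Context {R : realType}.
Local Notation plane := 'rV[R]_2.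

(* The library norm on 'rV[R]_2 is the sup norm (same topology), hence an
   explicit Euclidean distance. *)
Definition edist (x y : plane) : R :=
  Num.sqrt (\sum_(k < 2) (x ord0 k - y ord0 k) ^+ 2).

Definition equilateral (q : 'I_3 -> plane) : Prop :=
  exists2 a : R, 0 < a & forall i j, i != j -> edist (q i) (q j) = a.

Variable q : 'I_3 -> plane.

Definition F (i : 'I_3) (x : plane) : plane := 2^-1 *: (x + q i).

Definition Fw (w : word) : plane -> plane :=
  foldr (fun i f => F i \o f) idfun w.

Definition is_gasket (K : set plane) : Prop :=
  [/\ compact K, K !=set0 & K = \bigcup_(i : 'I_3) (F i @` K)].

Definition energy_ (m : nat) (u v : plane -> R) : R :=
  (5 / 3) ^+ m * \sum_(w : m.-tuple 'I_3) \sum_(i < 3) \sum_(j < 3 | (i < j)%N)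
    (u (Fw w (q i)) - u (Fw w (q j))) * (v (Fw w (q i)) - v (Fw w (q j))).

(* Meaningful for u and v of finite energy, where the limit exists. *)
Definition energy (u v : plane -> R) : R := limn (fun m => energy_ m u v).

(* Functions on the gasket are represented by functions on the plane, of which
   only the restriction to the gasket matters. *)
Definition harmonic_fun (K : set plane) (h : plane -> R) : Prop :=
  {within K, continuous h} /\ forall m n, energy_ m h h = energy_ n h h.

Definition harmonic_basis (K : set plane) (h : 'I_3 -> plane -> R) : Prop :=
  forall i, harmonic_fun K (h i) /\ forall j, h i (q j) = (i == j)%:R.

End Gasket.

Section Borel.
Context {R : realType}.
Local Notation plane := 'rV[R]_2.

(* K as a topological space of its own, with the subspace topology; measurable
   types are pointed, hence the proof of nonemptiness. *)
Definition subspace_type (K : set plane) (K0 : K !=set0) : Type := set_type K.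

Section Instances.
Variables (K : set plane) (K0 : K !=set0).
HB.instance Definition _ := Topological.copy (subspace_type K0) (set_type K).
HB.instance Definition _ := isPointed.Build (subspace_type K0)
  (exist _ (projT1 (cid K0)) (mem_set (projT2 (cid K0)))).
End Instances.

Definition borel (K : set plane) (K0 : K !=set0) :=
  g_sigma_algebraType (@open (subspace_type K0)).

(* F_w(K) as a subset of the space K. *)
Definition cell (q : 'I_3 -> plane) (K : set plane) (K0 : K !=set0) (w : word) :
    set (borel K0) :=
  [set x : subspace_type K0 | (Fw q w @` K) (\val x)].

Definition energy_measure (q : 'I_3 -> plane) (K : set plane) (K0 : K !=set0)
    (h : plane -> R) (nu : {finite_measure set (borel K0) -> \bar R}) : Prop :=
  forall w : word, nu (@cell q K K0 w) =
    ((5 / 3) ^+ size w * energy q (h \o Fw q w) (h \o Fw q w))%:E.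

Definition kusuoka (K : set plane) (K0 : K !=set0)
    (nu : 'I_3 -> {finite_measure set (borel K0) -> \bar R}) :
    {measure set (borel K0) -> \bar R} :=
  measure_add (measure_add (nu 0) (nu 1)) (nu 2).

End Borel.

Arguments cell {R} q {K} K0 w.

Section Matrices.
Context {R : realType}.

Definition mx3 (rows : seq (seq int)) : 'M[R]_3 :=
  \matrix_(i < 3, j < 3) (nth 0 (nth [::] rows i) j)%:~R.

Definition M (i : 'I_3) : 'M[R]_3 :=
  15^-1 *: mx3 (nth [::]
    [:: [:: [:: 9; 0; 0]; [:: 2; 2; -1]; [:: 2; -1; 2]];
        [:: [:: 2; 2; -1]; [:: 0; 9; 0]; [:: -1; 2; 2]];
        [:: [:: 2; -1; 2]; [:: -1; 2; 2]; [:: 0; 0; 9]]] i).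

Definition Mw (w : word) : 'M[R]_3 := \prod_(i <- w) M i.

Definition b (w : word) (j : 'I_3) : R :=
  1 / 6 + 1 / 2 * ((\sum_(i < 3) Mw w i j) /
                   (\sum_(i < 3) \sum_(k < 3) Mw w i k)).

End Matrices.

(* Main.v *)
Require Import Defs.
From mathcomp Require Import all_boot all_order all_algebra.
From mathcomp Require Import all_classical all_reals all_analysis.
From mathcomp Require Import ring lra.
Import Order.TTheory GRing.Theory Num.Theory.
Import numFieldNormedType.Exports.

Set Implicit Arguments.
Unset Strict Implicit.
Unset Printing Implicit Defensive.

(** The graph energies satisfy E_(m+1)(u) = 5/3 * sum_i E_m(u o F_i), and
    E_1(u) - E_0(u) is a positive definite quadratic form in the deviations of
    the values of u at the three midpoints from those given by the 1/5 - 2/5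
    rule ([energy_1B0]). So E_m(u) is nondecreasing in m for every u, and if it
    is constant then each E_m(u o F_i) is constant too ([const_energyF]) and u
    obeys the 1/5 - 2/5 rule at the midpoints ([const_energy_ext]). Every
    harmonic function is thus determined on the vertices of all cells, and the
    energy of u o F_w is the energy of the triangle of its vertex values.

    On functions with boundary values x, the energy measure is a quadratic
    form in x that vanishes on constants. These forms are spanned by
    c_i(x) = prod_(j <> i) (x_i - x_j), and c_i(e_k) = delta_ik where e_k is the
    boundary vector of h_k; hence the energy measure of u is
    sum_i c_i(x) nu_i. Restricting u to the cell F_j SG acts on the boundary
    vector by the extension rule and on the c_i by 3/5 times the matrix M_j
    ([vertex_form_ext]). Iterating along w gives ([basis_cell_energy])

      nu_i(F_w SG) = 2 * (sum of row i of M_w),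

    so that nu(F_w SG) is twice the sum S of all entries of M_w. Since M_j 1 is
    1/5 * 1 + 2/5 * e_j, passing from w to wj turns S into
    1/5 * S + 2/5 * (sum of column j of M_w), and the identity is then an
    equality of affine functions of (column sum) / S. The division makes sense
    because the extension rule is injective modulo constants
    ([tri_energy_ext]), whence S > 0. *)

Local Open Scope classical_set_scope.
Local Open Scope ring_scope.

(** * Indices *)

Lemma ord3_ind (P : 'I_3 -> Prop) : P 0 -> P 1 -> P 2 -> forall i, P i.
Proof.
move=> P0 P1 P2 [[|[|[|//]]] lt_i]; [have -> // : Ordinal lt_i = 0
  | have -> // : Ordinal lt_i = 1 | have -> // : Ordinal lt_i = 2];
  exact/val_inj.
Qed.

Lemma big_ord3 (T : Type) (idx : T) (op : Monoid.law idx) (f : 'I_3 -> T) :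
  \big[op/idx]_(i < 3) f i = op (f 0) (op (f 1) (f 2)).
Proof.
rewrite !big_ord_recl big_ord0 Monoid.mulm1.
by congr (op _ (op (f _) (f _))); exact/val_inj.
Qed.

(** * Harmonic functions on the cells *)

Section HarmonicExtension.
Variables (R : realType) (q : 'I_3 -> 'rV[R]_2).
Local Notation plane := 'rV[R]_2.
Implicit Types (u v : plane -> R) (x : 'I_3 -> R).

Definition tri_energy x : R :=
  (x 0 - x 1) ^+ 2 + (x 0 - x 2) ^+ 2 + (x 1 - x 2) ^+ 2.

(** The 1/5 - 2/5 rule: the values of a harmonic function with boundary values
    [x] at the vertices of the cell of index [i]. For [k != i] the value at the
    midpoint of the edge ik is 2/5 of [x i] and of [x k] plus 1/5 of the value
    at the third vertex. *)
Definition harmonic_ext (i : 'I_3) x (k : 'I_3) : R :=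
  if k == i then x i else (x 0 + x 1 + x 2 + x i + x k) / 5.

Lemma energy_0E u : energy_ q 0 u u = tri_energy (u \o q).
Proof.
rewrite /energy_ expr0 mul1r (big_pred1 [tuple]) => [|t]; last first.
  by apply/esym/eqP; exact: tuple0.
under eq_bigr do rewrite big_mkcond big_ord3.
rewrite big_ord3 /tri_energy /= /idfun.
ring.
Qed.

(** Splitting off the first letter of a word, the outermost contraction, is what
    makes every later induction on the level or on the word generalize over the
    function only. *)
Lemma energy_S m u v :
  energy_ q m.+1 u v =
  5 / 3 * \sum_(i < 3) energy_ q m (u \o F q i) (v \o F q i).
Proof.
rewrite /energy_ -mulr_sumr exprS -mulrA; congr (_ * (_ * _)).
rewrite [RHS]pair_big /=.
rewrite (reindex (fun p : 'I_3 * m.-tuple 'I_3 => [tuple of p.1 :: p.2])) //=.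
exists (fun t => (thead t, [tuple of behead t])) => [[i t] _|t _] /=.
  by congr (_, _); exact/val_inj.
by rewrite [RHS]tuple_eta; exact/val_inj.
Qed.

Lemma midpointC i j : F q i (q j) = F q j (q i).
Proof. by rewrite /F addrC. Qed.

Lemma fixpoint i : F q i (q i) = q i.
Proof. by rewrite /F -mulr2n -[q i *+ 2]scaler_nat scalerA mulVf ?scale1r. Qed.

Definition defect u (i j : 'I_3) : R :=
  u (F q i (q j)) - harmonic_ext i (u \o q) j.

(** In the energy of level 1 each midpoint value has degree 4 and is coupled to
    the two other ones. Completing squares around the minimizer, which is the
    1/5 - 2/5 rule, leaves 5/3 times the form with matrix 4 on the diagonal and
    -1 elsewhere, written here as a sum of squares. *)
Lemma energy_1B0 u :
  energy_ q 1 u u - energy_ q 0 u u =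
  5 / 3 * (2 * (defect u 0 1 ^+ 2 + defect u 0 2 ^+ 2 + defect u 1 2 ^+ 2) +
   ((defect u 0 1 - defect u 0 2) ^+ 2 + (defect u 0 1 - defect u 1 2) ^+ 2 +
    (defect u 0 2 - defect u 1 2) ^+ 2)).
Proof.
rewrite energy_S big_ord3 !energy_0E /tri_energy /defect /harmonic_ext /=.
rewrite !fixpoint (midpointC 1 0) (midpointC 2 0) (midpointC 2 1).
by field.
Qed.

Lemma energy_le_succ m u : energy_ q m u u <= energy_ q m.+1 u u.
Proof.
elim: m u => [|m IH] u.
  rewrite -subr_ge0 energy_1B0.
  apply: mulr_ge0; first lra.
  by rewrite !addr_ge0 ?sqr_ge0 // mulr_ge0 // !addr_ge0 ?sqr_ge0.
by rewrite 2!energy_S ler_wpM2l ?ler_sum //; lra.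
Qed.

Definition const_energy u := forall m n, energy_ q m u u = energy_ q n u u.

(** A sum of three quantities nondecreasing in the level can be constant only if
    each of them is. *)
Lemma const_energyF u i : const_energy u -> const_energy (u \o F q i).
Proof.
move=> uH.
suff E m : energy_ q m.+1 (u \o F q i) (u \o F q i)
         = energy_ q m (u \o F q i) (u \o F q i).
  have E0 m : energy_ q m (u \o F q i) (u \o F q i)
            = energy_ q 0 (u \o F q i) (u \o F q i).
    by elim: m => // m <-.
  by move=> m n; rewrite !E0.
have c0 : 5 / 3 != 0 :> R by apply: lt0r_neq0; lra.
have := uH m.+1 m.+2; rewrite !(energy_S _ u) => /(mulfI c0) /eqP.
have leE (k : 'I_3) : true ->
    energy_ q m (u \o F q k) (u \o F q k) <=
    energy_ q m.+1 (u \o F q k) (u \o F q k) ?= iff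
    (energy_ q m (u \o F q k) (u \o F q k) ==
     energy_ q m.+1 (u \o F q k) (u \o F q k)).
  by move=> _; split; first exact: energy_le_succ.
have [_ ->] := leif_sum leE.
by move=> /forallP /(_ i) /eqP.
Qed.

Lemma const_energy_ext u i : const_energy u ->
  u \o F q i \o q = harmonic_ext i (u \o q).
Proof.
move=> uH.
have /eqP : energy_ q 1 u u - energy_ q 0 u u = 0 by rewrite (uH 1%N 0%N) subrr.
rewrite energy_1B0 mulf_eq0 => /orP[/eqP ?|/eqP s0]; first by exfalso; lra.
have [d01 d02 d12] : [/\ defect u 0 1 = 0, defect u 0 2 = 0 & defect u 1 2 = 0].
  move: s0; set a := defect u 0 1; set b := defect u 0 2; set c := defect u 1 2.
  move: (sqr_ge0 a) (sqr_ge0 b) (sqr_ge0 c).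
  move: (sqr_ge0 (a - b)) (sqr_ge0 (a - c)) (sqr_ge0 (b - c)) => *.
  by split; apply/eqP; rewrite -sqrf_eq0 eq_le sqr_ge0 andbT; lra.
move: d01 d02 d12; rewrite /defect /harmonic_ext /= => d01 d02 d12.
apply/funext => k; move: i k.
by do 2!apply: ord3_ind => /=; rewrite ?fixpoint ?(midpointC 1 0)
  ?(midpointC 2 0) ?(midpointC 2 1) //=; lra.
Qed.

Lemma energy_const u : const_energy u -> energy q u u = tri_energy (u \o q).
Proof.
move=> uH; rewrite -energy_0E /energy.
have -> : (fun m => energy_ q m u u) = fun=> energy_ q 0 u u.
  by apply/funext => m; exact: uH.
exact: lim_cst.
Qed.

Lemma const_energyFw u w : const_energy u -> const_energy (u \o Fw q w).
Proof. by elim: w u => //= i w IH u uH; apply: (IH _ (const_energyF i uH)). Qed.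

(** The quadratic form dual to the boundary values of the harmonic basis: it is
    the coefficient of the measure of index [i] in the energy measure of a
    harmonic function with boundary values [x]. *)
Definition vertex_form x (i : 'I_3) : R := \prod_(j < 3 | j != i) (x i - x j).

(** The origin of the matrices M: they express how the quadratic forms transform
    when a harmonic function is restricted to a cell, the factor 5/3 being the
    renormalization of the energy. *)
Lemma vertex_form_ext x j k :
  5 / 3 * vertex_form (harmonic_ext j x) k =
  \sum_(i < 3) vertex_form x i * M j i k.
Proof.
rewrite big_ord3 /vertex_form !(big_mkcond (fun _ => _ != _)) !big_ord3.
move: j k; do 2!apply: ord3_ind; rewrite /M /mx3 !mxE /harmonic_ext /=;
  by field.
Qed.

(** The induction on [w] has to range over all harmonic [u], since it replaces
    [u] by its restriction to the first cell of [w]; this is why the formula is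
    stated for arbitrary boundary values. *)
Lemma cell_energyE u w : const_energy u ->
  (5 / 3) ^+ size w * tri_energy (u \o Fw q w \o q) =
  2 * \sum_(i < 3) vertex_form (u \o q) i * \sum_(k < 3) Mw w i k.
Proof.
elim: w u => [|j w IH] u uH.
  rewrite expr0 mul1r !big_ord3 /vertex_form !(big_mkcond (fun _ => _ != _)).
  rewrite !big_ord3 /Mw big_nil !mxE /tri_energy /= /idfun; ring.
have {}IH := IH _ (const_energyF j uH).
rewrite [size _]/= exprS -mulrA -[u \o Fw q (j :: w)]/(u \o F q j \o Fw q w) IH.
rewrite mulrCA; congr (_ * _).
rewrite const_energy_ext // mulr_sumr.
under eq_bigr do rewrite mulrA vertex_form_ext mulr_suml.
rewrite exchange_big /=; apply: eq_bigr => i _.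
rewrite /Mw big_cons.
under [in RHS]eq_bigr do rewrite mxE.
rewrite exchange_big mulr_sumr; apply: eq_bigr => k _ /=.
by rewrite -mulr_sumr mulrA.
Qed.

(** On functions modulo constants the extension rule to a cell has eigenvalues
    3/5 and 1/5, with eigenvectors orthogonal for the energy: the constant 25 is
    the inverse square of the smaller one. *)
Lemma tri_energy_ext x j : tri_energy x <= 25 * tri_energy (harmonic_ext j x).
Proof.
(* The coordinates of x along the two eigenvectors are, for j = 0, multiples of
   2 x_0 - x_1 - x_2 and x_1 - x_2; the difference of the two sides is a
   multiple of the square of the first. *)
move: j; apply: ord3_ind; rewrite /tri_energy /harmonic_ext /=.
- have := sqr_ge0 (2 * x 0 - x 1 - x 2); lra.
- have := sqr_ge0 (2 * x 1 - x 0 - x 2); lra.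
- have := sqr_ge0 (2 * x 2 - x 0 - x 1); lra.
Qed.

Lemma tri_energyFw_gt0 u w : const_energy u ->
  0 < tri_energy (u \o q) -> 0 < tri_energy (u \o Fw q w \o q).
Proof.
elim: w u => //= j w IH u uH u0; apply: (IH _ (const_energyF j uH)).
rewrite const_energy_ext //; have := tri_energy_ext (u \o q) j; lra.
Qed.

End HarmonicExtension.

(** * The Kusuoka measure of a cell *)

Section Kusuoka.
Variables (R : realType) (q : 'I_3 -> 'rV[R]_2).
Variables (K : set 'rV[R]_2) (K0 : K !=set0) (h : 'I_3 -> 'rV[R]_2 -> R).
Context (hh : harmonic_basis q K h).

Lemma basis_values i : h i \o q = fun j => (i == j)%:R.
Proof. by apply/funext => j /=; case: (hh i). Qed.

Lemma basis_const_energy i : const_energy q (h i).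
Proof. by case: (hh i) => -[]. Qed.

Lemma vertex_form_basis i k :
  vertex_form (fun j => (i == j)%:R : R) k = (i == k)%:R.
Proof.
rewrite /vertex_form (big_mkcond (fun _ => _ != _)) big_ord3.
by move: i k; do 2!apply: ord3_ind; rewrite /=; ring.
Qed.

Lemma basis_cell_energy i w :
  (5 / 3) ^+ size w * tri_energy (h i \o Fw q w \o q) =
  2 * \sum_(k < 3) Mw w i k.
Proof.
rewrite cell_energyE; last exact: basis_const_energy.
congr (_ * _); rewrite (bigD1 i) //= [X in _ + X]big1 => [|k /negPf ki].
  by rewrite basis_values vertex_form_basis eqxx mul1r addr0.
by rewrite basis_values vertex_form_basis eq_sym ki mul0r.
Qed.

(** The matrices M have negative entries, so the sign comes from the energy
    that the row sum represents. *)
Lemma Mw_rowsum_gt0 i w : 0 < \sum_(k < 3) Mw w i k :> R.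
Proof.
rewrite -(@pmulr_rgt0 _ 2) // -basis_cell_energy mulr_gt0 ?exprn_gt0 //.
apply: tri_energyFw_gt0; first exact: basis_const_energy.
by rewrite basis_values /tri_energy; move: i; apply: ord3_ind => /=; lra.
Qed.

Lemma kusuoka_cell (nu : 'I_3 -> {finite_measure set (borel K0) -> \bar R}) w :
  (forall i, energy_measure q (h i) (nu i)) ->
  fine (kusuoka nu (cell q K0 w)) = 2 * \sum_(i < 3) \sum_(k < 3) Mw w i k.
Proof.
move=> hnu.
have nuE i : nu i (cell q K0 w) = (2 * \sum_(k < 3) Mw w i k)%:E.
  rewrite hnu energy_const ?basis_cell_energy //.
  exact/const_energyFw/basis_const_energy.
have -> : kusuoka nu (cell q K0 w) =
    (nu 0%R (cell q K0 w) + nu 1%R (cell q K0 w) + nu 2%R (cell q K0 w))%E.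
  by rewrite /kusuoka [LHS]measure_addE; congr (_ + _)%E; exact: measure_addE.
by rewrite !nuE /= [X in _ = 2 * X]big_ord3 !mulrDr addrA.
Qed.

End Kusuoka.

Lemma M_rowsum (R : realType) (j i : 'I_3) :
  \sum_(k < 3) M j i k = 1 / 5 + 2 / 5 * (i == j)%:R :> R.
Proof.
rewrite big_ord3; move: j i.
by do 2!apply: ord3_ind; rewrite /M /mx3 !mxE /=; field.
Qed.

Lemma Mw_rcons_sum (R : realType) w j :
  \sum_(i < 3) \sum_(k < 3) Mw (rcons w j) i k =
  1 / 5 * (\sum_(i < 3) \sum_(k < 3) Mw w i k) +
  2 / 5 * (\sum_(i < 3) Mw w i j) :> R.
Proof.
rewrite !mulr_sumr -big_split; apply: eq_bigr => i _ /=.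
have -> : Mw (rcons w j) = Mw w * M j :> 'M[R]_3.
  by rewrite /Mw -cats1 big_cat big_seq1.
under eq_bigr do rewrite mxE.
rewrite exchange_big /=.
under eq_bigr do rewrite -mulr_sumr M_rowsum mulrDr.
rewrite big_split /= -mulr_suml mulrC; congr (_ + _).
rewrite (bigD1 j) //= [X in _ + X]big1 => [|k /negPf ->]; last first.
  by rewrite !mulr0.
by rewrite eqxx mulr1 addr0 mulrC.
Qed.

Theorem theorem6p3 (R : realType) (q : 'I_3 -> 'rV[R]_2) (hq : equilateral q)
  (SG : set 'rV[R]_2) (hSG : is_gasket q SG) (SG0 : SG !=set0)
  (h : 'I_3 -> 'rV[R]_2 -> R) (hh : harmonic_basis q SG h)
  (nu : 'I_3 -> {finite_measure set (borel SG0) -> \bar R})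
  (hnu : forall i : 'I_3, energy_measure q (h i) (nu i))
  (w : seq 'I_3) (j : 'I_3) :
  1 / 5 * (b w j - 1 / 3) =
  1 / 4 * (fine (kusuoka nu (cell q SG0 (rcons w j))) /
           fine (kusuoka nu (cell q SG0 w)) - 1 / 3).
Proof.
rewrite !(kusuoka_cell hh) // Mw_rcons_sum /b.
have : 0 < \sum_(i < 3) \sum_(k < 3) (Mw w i k : R).
  by rewrite big_ord3 !addr_gt0 ?(Mw_rowsum_gt0 hh).
set S := \sum_(i < 3) \sum_(k < 3) _; move=> /lt0r_neq0 S0.
by field.
Qed.
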